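(* Let $X, Y$ be locally convex Hausdorff topological vector spaces, $M: X \to Y$ a continuous linear mapping, $D \subset X$ a generalized polyhedral convex set, and $K=\{ y \in Y \mid \langle y^*_j, y \rangle \leq 0,\ j=1,\dots,q\}$ a polyhedral convex cone, where $y^*_j \in Y^*\setminus\{0\}$ for $j=1,\dots,q$. Then the efficient solution set $E$ of the problem (VLP) $\min_K\{Mx \mid x \in D\}$ is the union of finitely many generalized polyhedral convex sets.
   Context: All vector spaces are real. $X^*$ denotes the (continuous) dual of $X$ and $\langle x^*,x\rangle$ the value of $x^*\in X^*$ at $x\in X$; likewise for $Y$. A subset $C\subset X$ is a generalized polyhedral convex set (generalized convex polyhedron) if there exist $x^*_i\in X^*$, $\alpha_i\in\mathbb R$, $i=1,\dots,p$, and a closed affine subspace $L\subset X$ such that $C=\{x\in X\mid x\in L,\ \langle x^*_i,x\rangle\le\alpha_i,\ i=1,\dots,p\}$. $\ell(K)=K\cap(-K)$. A vector $u\in D$ is an efficient solution of (VLP) if there is no $x\in D$ with $Mu-Mx\in K\setminus\ell(K)$; $E$ is the set of all efficient solutions. *)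

(* Defs.v *)
From HB Require Import structures.
From mathcomp Require Import all_boot all_order all_algebra.
From mathcomp Require Import all_classical all_reals all_analysis.

Set Implicit Arguments.
Unset Strict Implicit.
Unset Printing Implicit Defensive.

Import Order.TTheory GRing.Theory Num.Theory.
Import numFieldNormedType.Exports.

Local Open Scope classical_set_scope.
Local Open Scope ring_scope.

Record topdual (R : realType) (X : tvsType R) := TopDual {
  topdual_linear :> {linear X -> R^o} ;
  topdual_continuous : continuous topdual_linear
}.

Definition affine_subspace (R : realType) (X : lmodType R) (L : set X) : Prop :=
  exists (x0 : X) (V : {pred X}),
    submod_closed V /\ L = [set x0 + v | v in [set` V]].

(* The family of inequalities may be empty, and the functionals may be zero;
   in particular set0 is generalized polyhedral. *)
Definition generalized_polyhedral (R : realType) (X : tvsType R) (C : set X)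
    : Prop :=
  exists (p : nat) (xstar : 'I_p -> topdual X) (alpha : 'I_p -> R) (L : set X),
    [/\ closed L, affine_subspace L &
        C = [set x | L x /\ forall i, xstar i x <= alpha i]].

Definition polyhedral_cone (R : realType) (Y : tvsType R) (q : nat)
    (ystar : 'I_q -> topdual Y) : set Y :=
  [set y | forall j, ystar j y <= 0].

Definition lineality (R : realType) (Y : lmodType R) (K : set Y) : set Y :=
  K `&` (-%R @` K).

Definition efficient_set (R : realType) (X Y : lmodType R) (M : X -> Y)
    (D : set X) (K : set Y) : set X :=
  [set u | D u /\ ~ exists2 x, D x & (K `\` lineality K) (M u - M x)].

(* Main.v *)
Require Import Defs.
From HB Require Import structures.
From mathcomp Require Import all_boot all_order all_algebra.
From mathcomp Require Import all_classical all_reals all_analysis.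

Set Implicit Arguments.
Unset Strict Implicit.
Unset Printing Implicit Defensive.

Import Order.TTheory GRing.Theory Num.Theory.
Import numFieldNormedType.Exports.

Local Open Scope classical_set_scope.
Local Open Scope ring_scope.

(** Write [D] as the part of a closed affine subspace [L] cut out by the
    inequalities [g i x <= alpha i].  The point is that whether [u] in [D] is
    efficient depends only on the set [I(u)] of constraints active at [u], and
    efficiency is inherited when more constraints become active.  Indeed, let
    [v] in [D] satisfy [I(u) `<=` I(v)], and suppose that some [x] in [D]
    dominates [v].  The direction [x - v] is feasible at [u]: it is parallel to
    [L]; a constraint active at [u] is active at [v], so it does not increase
    from [v] to [x]; and a constraint inactive at [u] has slack there.  Hence
    [u + t (x - v)] lies in [D] for a small [t > 0] ([feasible_step]).  As
    [M u - M (u + t (x - v)) = t (M v - M x)] and [K] minus its lineality space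
    is stable under positive scaling, this point dominates [u]
    ([efficient_active_sub]).

    So the efficient set is the union, over the active sets [I] of efficient
    points, of the faces of [D] on which the constraints of [I] hold with
    equality.  There are finitely many such [I], and each face is generalized
    polyhedral because an equality is a pair of inequalities. *)

(** The value of [t] below works even where [c i = 0]: there [`|d i| / c i = 0],
    and the sign hypothesis on [d i] takes over. *)
Lemma ex_small_step (R : realFieldType) (p : nat) (c d : 'I_p -> R) :
  (forall i, 0 <= c i) -> (forall i, c i = 0 -> d i <= 0) ->
  exists2 t : R, 0 < t & forall i, t * d i <= c i.
Proof.
move=> c0 d0; pose s := 1 + \sum_i `|d i| / c i.
have r0 i : 0 <= `|d i| / c i by rewrite divr_ge0.
have s0 : 0 < s by rewrite ltr_pwDl// sumr_ge0.
exists s^-1 => [|i]; first by rewrite invr_gt0.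
rewrite ler_pdivrMl//; have [ci0|ci0] := eqVneq (c i) 0.
  by rewrite ci0 mulr0 d0.
have cp : 0 < c i by rewrite lt_neqAle eq_sym ci0 c0.
rewrite -ler_pdivrMr// (@le_trans _ _ (`|d i| / c i))//.
  by rewrite ler_pM2r ?invr_gt0// ler_norm.
by rewrite /s (bigD1 i)//= addrCA lerDl addr_ge0// sumr_ge0.
Qed.

Lemma affine_subspace_translate (R : realType) (X : lmodType R) (L : set X)
    (u v x : X) (t : R) :
  affine_subspace L -> L u -> L v -> L x -> L (u + t *: (x - v)).
Proof.
move=> [x0 [V [[V0 VD] ->]]] [a Va <-] [b Vb <-] [c Vc <-].
exists (t *: (c - b) + a); last first.
  by rewrite opprD addrACA subrr add0r -addrA [a + _]addrC.
by apply: (VD) => //; rewrite addrC -scaleN1r; apply: VD.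
Qed.

Definition active_set (R : realType) (X : tvsType R) (p : nat)
    (g : 'I_p -> topdual X) (alpha : 'I_p -> R) (x : X) : {set 'I_p} :=
  [set i | g i x == alpha i].

Lemma feasible_step (R : realType) (X : tvsType R) (p : nat)
    (g : 'I_p -> topdual X) (alpha : 'I_p -> R) (L D : set X) (u v x : X) :
  affine_subspace L -> D = [set x | L x /\ forall i, g i x <= alpha i] ->
  D u -> D v -> D x -> active_set g alpha u \subset active_set g alpha v ->
  exists2 t : R, 0 < t & D (u + t *: (x - v)).
Proof.
move=> affL -> [Lu gu] [Lv gv] [Lx gx] /fintype.subsetP sub.
have [|i /eqP|t t0 ht] := @ex_small_step _ _ (fun i => alpha i - g i u)
  (fun i => g i x - g i v).
- by move=> i; rewrite subr_ge0.
- rewrite subr_eq0 eq_sym => act_u.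
  have : i \in active_set g alpha v by apply: sub; rewrite inE.
  by rewrite inE => /eqP ->; rewrite subr_le0.
exists t => //; split; first exact: affine_subspace_translate.
by move=> i; rewrite linearD linearZ linearB /= addrC -lerBrDr; exact: ht.
Qed.

Lemma polyhedral_cone_scale (R : realType) (Y : tvsType R) (q : nat)
    (ystar : 'I_q -> topdual Y) (t : R) (y : Y) :
  0 < t -> polyhedral_cone ystar y -> polyhedral_cone ystar (t *: y).
Proof. by move=> t0 Ky j; rewrite linearZ /= pmulr_rle0. Qed.

Lemma setD_lineality_scale (R : realType) (Y : lmodType R) (K : set Y) (t : R)
    (y : Y) :
  (forall s z, 0 < s -> K z -> K (s *: z)) -> 0 < t ->
  (K `\` lineality K) y -> (K `\` lineality K) (t *: y).
Proof.
move=> coneK t0 [Ky nly]; split; first exact: coneK.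
move=> [_ [z Kz zE]]; apply: nly; split=> //.
exists (t^-1 *: z); first by apply: coneK; rewrite ?invr_gt0.
by rewrite -scalerN zE scalerA mulVf ?scale1r// gt_eqF.
Qed.

(** A point dominating [v] yields a point dominating [u], by transporting the
    improving direction from [v] to [u]. *)
Lemma efficient_active_sub (R : realType) (X : tvsType R) (Y : lmodType R)
    (M : {linear X -> Y}) (K : set Y) (p : nat) (g : 'I_p -> topdual X)
    (alpha : 'I_p -> R) (L D : set X) (u v : X) :
  (forall s z, 0 < s -> K z -> K (s *: z)) ->
  affine_subspace L -> D = [set x | L x /\ forall i, g i x <= alpha i] ->
  active_set g alpha u \subset active_set g alpha v ->
  efficient_set M D K u -> D v -> efficient_set M D K v.
Proof.
move=> coneK affL DE sub [Du effu] Dv; split=> // -[x Dx domv]; apply: effu.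
have [t t0 Dt] := feasible_step affL DE Du Dv Dx sub.
exists (u + t *: (x - v)) => //.
have -> : M u - M (u + t *: (x - v)) = t *: (M v - M x).
  by rewrite linearD linearZ linearB /= opprD addrA subrr add0r -scalerN opprB.
exact: setD_lineality_scale.
Qed.

Lemma topdual_opp_continuous (R : realType) (X : tvsType R) (f : topdual X) :
  continuous (\- (f : {linear X -> R^o}) : {linear X -> R^o}).
Proof. by move=> x; apply: cvgN; exact: topdual_continuous. Qed.

Definition topdual_opp (R : realType) (X : tvsType R) (f : topdual X) :
  topdual X := TopDual (@topdual_opp_continuous R X f).

(** Each constraint is listed a second time, reversed when its index is in [I]
    so that the two copies amount to an equality. *)
Lemma generalized_polyhedral_face (R : realType) (X : tvsType R) (p : nat)
    (g : 'I_p -> topdual X) (alpha : 'I_p -> R) (L D : set X) (I : {set 'I_p}) :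
  closed L -> affine_subspace L ->
  D = [set x | L x /\ forall i, g i x <= alpha i] ->
  generalized_polyhedral [set x | D x /\ I \subset active_set g alpha x].
Proof.
move=> clL affL ->.
exists (p + p)%N, (fun k => match fintype.split k with
    | inl i => g i
    | inr i => if i \in I then topdual_opp (g i) else g i end),
  (fun k => match fintype.split k with
    | inl i => alpha i
    | inr i => if i \in I then - alpha i else alpha i end), L.
split=> //; apply/seteqP; split=> x.
  move=> [[Lx gx] /fintype.subsetP sub]; split=> // k.
  case: fintype.split => i //; case: ifP => // /sub.
  by rewrite inE /= => /eqP ->.
move=> [Lx gx]; have gle i : g i x <= alpha i.
  by have := gx (unsplit (inl i)); rewrite unsplitK.
split=> //; apply/fintype.subsetP => i iI; rewrite inE eq_le gle /=.
by have := gx (unsplit (inr i)); rewrite unsplitK iI lerN2.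
Qed.

Theorem theorem3p2 (R : realType) (X Y : tvsType R)
    (hX : hausdorff_space X) (hY : hausdorff_space Y)
    (M : {linear X -> Y}) (hM : continuous M)
    (D : set X) (hD : generalized_polyhedral D)
    (q : nat) (ystar : 'I_q -> topdual Y)
    (hystar : forall j, (ystar j : Y -> R^o) <> \0)
    (K : set Y) (hK : K = polyhedral_cone ystar) :
  exists (n : nat) (C : 'I_n -> set X),
    (forall i, generalized_polyhedral (C i)) /\
    efficient_set M D K = \bigcup_i C i.
Proof.
have coneK s z : 0 < s -> K z -> K (s *: z).
  by rewrite hK; exact: polyhedral_cone_scale.
have [p [g [alpha [L [clL affL DE]]]]] := hD.
pose S := [set I : {set 'I_p} |
  `[< exists2 u, efficient_set M D K u & I = active_set g alpha u >]]%SET.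
pose I (k : 'I_#|S|) : {set 'I_p} := enum_val k.
exists #|S|,
  (fun k => [set x | D x /\ I k \subset active_set g alpha x]).
split=> [k|]; first exact: generalized_polyhedral_face clL affL DE.
apply/seteqP; split=> [u Eu|v [k _ [Dv sub]]].
  have uS : active_set g alpha u \in S by rewrite inE; apply/asboolP; exists u.
  by exists (enum_rank_in uS (active_set g alpha u)) => //=;
    rewrite /I enum_rankK_in//; split=> //; case: Eu.
have := enum_valP k; rewrite inE => /asboolP[u Eu IE].
by apply: (efficient_active_sub coneK affL DE _ Eu Dv); rewrite -IE.
Qed.
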